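(* Let $L=(q_i)_{i\ge1}$ be a sequence of pairwise relatively prime non-negative integers, let $I=(a_j)_{j\ge1}$ be a sequence with every $a_j\in L$ and each $q_i$ appearing infinitely many times in $I$, and let $J=(b_i)_{i\ge1}$ be a strictly increasing sequence of non-negative integers with $\gcd(q_i,b_j)=1$ for all $i,j\ge1$. Let $\mathfrak{n}(I)=\prod_j a_j$ and $\mathfrak{n}(J)=\prod_i b_i$. Then for every generalized integer $\mathfrak{m}$ coprime with $\mathfrak{n}(I)\cdot\mathfrak{n}(J)$ there exists a simple Riesz group of rank one $G(\mathfrak{m})$ such that: (i) for every $q_i$ there is a countably generated interval $D_i\subseteq G(\mathfrak{m})^+$ with $tD_i\neq G(\mathfrak{m})^+$ for every positive integer $t\le q_i-1$ and $q_iD_i=G(\mathfrak{m})^+$; (ii) there is an interval $D\subseteq G(\mathfrak{m})^+$ with $nD\neq G(\mathfrak{m})^+$ for all $n\in\mathbb{N}$; (iii) for some generalized integer $\mathfrak{n}$ dividing $\mathfrak{n}(J)$, $G(\mathfrak{m})$ is isomorphic, as an abelian group, to $\mathbb{Z}_{\mathfrak{n}(I)\cdot\mathfrak{n}\cdot\mathfrak{m}}$.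
   Context: Partially ordered abelian group $(G,G^+)$; simple: $G\neq0$ and every nonzero $u\in G^+$ is an order-unit. Riesz group: $x\le y_1+y_2$ in $G^+$ implies $x=x_1+x_2$, $x_j\in G^+$, $x_j\le y_j$. Rank one: isomorphic to a nonzero subgroup of $\mathbb{Q}$. Generalized integers: maps from primes to $\{0,1,\dots,\infty\}$; products add exponents; an infinite product of integers has at each prime the sum of exponents; $\mathfrak{n}\mid\mathfrak{m}$ if $\mathfrak{m}=\mathfrak{n}\mathfrak{n}'$; coprime: at each prime one exponent is $0$. $\mathbb{Z}_{\mathfrak{n}}=\{a/b\in\mathbb{Q}: b\mid\mathfrak{n}\}$. An interval in $G^+$ is a nonempty, upward directed, order-hereditary subset of $G^+$; countably generated if it has a countable cofinal subset; $tX=\{z\in G^+: z\le x_1+\dots+x_t,\ x_i\in X\}$. *)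

(* Defs.v *)
From HB Require Import structures.
From mathcomp Require Import all_boot all_order all_algebra.
From Stdlib Require Import ClassicalEpsilon.
Set Implicit Arguments. Unset Strict Implicit. Unset Printing Implicit Defensive.
Import Order.TTheory GRing.Theory Num.Theory.
Local Open Scope ring_scope.

Definition pleq (G : zmodType) (P : G -> Prop) (x y : G) : Prop := P (y - x).

Definition is_po_group (G : zmodType) (P : G -> Prop) : Prop :=
  P 0 /\ (forall x y, P x -> P y -> P (x + y)) /\
  (forall x, P x -> P (- x) -> x = 0).

Definition order_unit (G : zmodType) (P : G -> Prop) (u : G) : Prop :=
  P u /\ forall x : G, exists n : nat, pleq P x (u *+ n).

Definition is_simple (G : zmodType) (P : G -> Prop) : Prop :=
  (exists x : G, x != 0) /\ forall u, P u -> u != 0 -> order_unit P u.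

Definition is_riesz (G : zmodType) (P : G -> Prop) : Prop :=
  forall x y1 y2 : G, P x -> P y1 -> P y2 -> pleq P x (y1 + y2) ->
    exists x1 x2, x = x1 + x2 /\ P x1 /\ P x2 /\ pleq P x1 y1 /\ pleq P x2 y2.

Definition rank_one (G : zmodType) : Prop :=
  (exists f : G -> rat, (forall x y, f (x + y) = f x + f y) /\ injective f) /\
  (exists x : G, x != 0).

Definition is_interval (G : zmodType) (P : G -> Prop) (X : G -> Prop) : Prop :=
  (forall x, X x -> P x) /\
  (exists x, X x) /\
  (forall x y, X x -> X y -> exists z, X z /\ pleq P x z /\ pleq P y z) /\
  (forall x y, X x -> P y -> pleq P y x -> X y).

(* countably generated: X has a countable cofinal subset (X is nonempty, so
   such a subset can be enumerated by nat) *)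
Definition countably_generated (G : zmodType) (P : G -> Prop) (X : G -> Prop) : Prop :=
  exists c : nat -> G, (forall n, X (c n)) /\ forall x, X x -> exists n, pleq P x (c n).

Definition mult_set (G : zmodType) (P : G -> Prop) (t : nat) (X : G -> Prop) : G -> Prop :=
  fun z => P z /\ exists xs : seq G,
    size xs = t /\ (forall x, x \in xs -> X x) /\ pleq P z (\sum_(x <- xs) x).

Definition is_cone (G : zmodType) (P : G -> Prop) (S : G -> Prop) : Prop :=
  forall z, S z <-> P z.

(* A generalized integer is given by its exponent at each prime p
   (None = infinity); values at non-primes are irrelevant. *)
Definition gint := nat -> option nat.

Definition eadd (a b : option nat) : option nat :=
  match a, b with Some x, Some y => Some (x + y)%N | _, _ => None end.

Definition gmul (n m : gint) : gint := fun p => eadd (n p) (m p).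

Definition geq (n m : gint) : Prop := forall p, prime p -> n p = m p.

Definition gdvd (n m : gint) : Prop := exists n' : gint, geq m (gmul n n').

Definition gcoprime (n m : gint) : Prop :=
  forall p, prime p -> n p = Some 0%N \/ m p = Some 0%N.

Definition gint_of_nat (k : nat) : gint := fun p => Some (logn p k).

Definition esum (e : nat -> nat) : option nat :=
  match excluded_middle_informative
          (exists k : nat, exists N0 : nat, forall N, (N0 <= N)%N ->
                 (\sum_(j < N) e j)%N = k) with
  | left H => Some (proj1_sig (constructive_indefinite_description _ H))
  | right _ => None
  end.

Definition gprod (f : nat -> nat) : gint := fun p => esum (fun j => logn p (f j)).

Definition Zgen (N : gint) (x : rat) : Prop :=
  exists (a : int) (b : nat), (0 < b)%N /\ gdvd (gint_of_nat b) N /\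
    x = a%:~R / b%:R.

Definition iso_Zgen (G : zmodType) (N : gint) : Prop :=
  exists f : G -> rat, (forall x y, f (x + y) = f x + f y) /\ injective f /\
    (forall x, Zgen N (f x)) /\ (forall y, Zgen N y -> exists x, f x = y).

(* Main.v *)
Require Import Defs.
From HB Require Import structures.
From mathcomp Require Import all_boot all_order all_algebra.
From mathcomp Require Import ring lra zify.
From Stdlib Require Import Classical ClassicalEpsilon.
Set Implicit Arguments. Unset Strict Implicit. Unset Printing Implicit Defensive.
Import Order.TTheory GRing.Theory Num.Theory.
Local Open Scope ring_scope.

(** The group is an increasing union of cyclic groups [1/N Z], and its cone is a
    union of submonoids [C] of their nonnegative parts, each containing every
    large element of its [1/N Z]. Adjoining to [C] a large generator [d] of
    [1/(N r) Z] adds nothing to [C] inside [1/N Z], because [d] has order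
    exactly [r] modulo [1/N Z]. Taking [r = v] and adding [d] to the current top
    [X] of a chain makes [v X] dominate more and more of the cone, whereas
    [(v - 1) X - 1] never enters it: the downset [D] of the chain satisfies
    [v D = G+] and [1] is not in [(v - 1) D]. Taking for [r] factors whose product
    is [m] provides the remaining denominators. To split [x <= y1 + y2], choose a
    rational [d] strictly inside the interval allowed by the real order, of large
    order [r = b i] modulo [1/N Z], and adjoin [d], [x - d], [y1 - d] and
    [y2 - x + d]. The new elements of [1/N Z] are then all large, hence different
    from the elements [(v - 1) X - 1], which are bounded at each stage. *)

(** * Subgroups of the rationals as abelian groups *)

Record subg (S : zmodClosed rat) := Subg { subg_val : rat; _ : subg_val \in S }.
HB.instance Definition _ (S : zmodClosed rat) := [isSub of subg S for @subg_val S].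
HB.instance Definition _ (S : zmodClosed rat) := [Choice of subg S by <:].
HB.instance Definition _ (S : zmodClosed rat) := [SubChoice_isSubZmodule of subg S by <:].

Lemma subgroup_zmodType (S : rat -> Prop) :
  S 0 -> (forall x y, S x -> S y -> S (x - y)) ->
  exists (G : zmodType) (f : {additive G -> rat}),
    injective f /\ (forall x, S (f x)) /\ (forall y, S y -> exists x, f x = y).
Proof.
move=> S0 SB.
(* Excluded middle makes membership boolean, as the subtype construction requires. *)
pose S' : {pred rat} := fun x => if excluded_middle_informative (S x) then true else false.
have S'P x : reflect (S x) (x \in S').
  by rewrite /S' unfold_in; case: excluded_middle_informative => H; constructor.
have S'B : zmod_closed S'.
  by split; [exact/S'P | move=> x y /S'P xS /S'P yS; apply/S'P/SB].
pose T : zmodClosed rat := HB.pack S' (GRing.isZmodClosed.Build rat S' S'B).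
exists (subg T), (val : {additive subg T -> rat}); split; first exact: val_inj.
split=> [x | y yS]; first exact/S'P/(valP x).
have yT : y \in T by apply/S'P.
by exists (Subg yT).
Qed.

Lemma epsilon_choice (A B : Type) (R : A -> B -> Prop) :
  (forall x, exists y, R x y) -> exists f : A -> B, forall x, R x (f x).
Proof.
move=> h; exists (fun x => proj1_sig (constructive_indefinite_description _ (h x))).
by move=> x; case: constructive_indefinite_description.
Qed.

(** * Generalized integers, compared through the finite exponents below theirs *)

Definition ele (l : nat) (o : option nat) : bool :=
  if o is Some k then (l <= k)%N else true.

Lemma ele_inj o o' : ele^~ o =1 ele^~ o' -> o = o'.
Proof.
case: o o' => [x|] [y|] // e; last 2 first.
- by move: (e x.+1); rewrite /= ltnn.
- by move: (e y.+1); rewrite /= ltnn.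
congr Some; apply/eqP; rewrite eqn_leq.
by have /= <- := e x; have /= -> := e y; rewrite !leqnn.
Qed.

Lemma ele_eadd l o o' :
  ele l (eadd o o') <-> exists l1 l2, l = (l1 + l2)%N /\ ele l1 o /\ ele l2 o'.
Proof.
case: o o' => [x|] [y|] /=; split=> //.
- by move=> h; exists (minn l x), (l - x)%N; lia.
- by move=> [? [? [-> [? ?]]]]; lia.
- by exists 0, l.
- by exists l, 0; rewrite addn0.
- by exists l, 0; rewrite addn0.
Qed.

Lemma leq_sum_ord (e : nat -> nat) N N' :
  (N <= N')%N -> (\sum_(j < N) e j <= \sum_(j < N') e j)%N.
Proof.
move=> /subnKC <-; elim: (N' - N)%N => [|k IH]; first by rewrite addn0.
by rewrite addnS big_ord_recr /=; apply: leq_trans IH (leq_addr _ _).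
Qed.

(** Partial sums are nondecreasing: either they reach a final constant value, which is their
    maximum, or they pass every bound. *)
Lemma ele_esum e l : ele l (esum e) <-> exists N, (l <= \sum_(j < N) e j)%N.
Proof.
rewrite /esum; case: excluded_middle_informative => [H|nH] /=.
  case: constructive_indefinite_description => k [N0 kE] /=; split=> [lk|[N lN]].
    by exists N0; rewrite kE.
  rewrite -(kE (maxn N0 N) (leq_maxl _ _)).
  exact: leq_trans lN (leq_sum_ord _ (leq_maxr _ _)).
split=> // _; elim: l => [|l [N lN]]; first by exists 0.
apply: NNPP => nl; apply: nH; exists l, N => N' NN'.
apply/eqP; rewrite eqn_leq (leq_trans lN (leq_sum_ord _ NN')) andbT leqNgt.
by apply/negP => h; apply: nl; exists N'.
Qed.

Lemma gdvdP n m :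
  gdvd n m <-> forall p, prime p -> forall l, ele l (n p) -> ele l (m p).
Proof.
split=> [[n' e] p pp l h|h].
  rewrite e // /gmul; apply/ele_eadd.
  by exists l, 0; rewrite addn0; split=> //; split=> //; case: (n' p).
(* The default [0] is never reached at a prime: [h] excludes an infinite exponent of [n] over a
   finite exponent of [m]. *)
exists (fun p => if m p is Some x then
                   Some (if n p is Some y then (x - y)%N else 0) else None).
move=> p pp; rewrite /gmul; case: (n p) (h p pp) => [y|] hp.
  case: (m p) hp => // x hp /=.
  by congr Some; rewrite subnKC //; apply: hp => /=.
by case: (m p) hp => // x /(_ x.+1 isT) /=; rewrite ltnn.
Qed.

Lemma gprodM f g : (forall k, 0 < f k)%N -> (forall k, 0 < g k)%N ->
  Defs.geq (gprod (fun k => f k * g k)%N) (gmul (gprod f) (gprod g)).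
Proof.
move=> f0 g0 p pp; apply: ele_inj => l; apply/idP/idP; rewrite /gmul /gprod.
  move=> /ele_esum [N]; under eq_bigr do rewrite lognM //.
  rewrite big_split /= => lN; apply/ele_eadd.
  set s := (\sum_(i < N) logn p (f i))%N in lN.
  exists (minn l s), (l - s)%N; split; first by lia.
  by split; apply/ele_esum; exists N; rewrite ?geq_minr ?leq_subLR.
move=> /ele_eadd [l1 [l2 [-> [/ele_esum [N1 h1] /ele_esum [N2 h2]]]]].
apply/ele_esum; exists (maxn N1 N2).
under eq_bigr do rewrite lognM //.
rewrite big_split /=; apply: leq_add.
  exact: leq_trans h1 (leq_sum_ord (fun i => logn p (f i)) (leq_maxl _ _)).
exact: leq_trans h2 (leq_sum_ord (fun i => logn p (g i)) (leq_maxr _ _)).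
Qed.

Lemma logn_prod (F : nat -> nat) p k : (forall i, 0 < F i)%N ->
  logn p (\prod_(i < k) F i) = (\sum_(i < k) logn p (F i))%N.
Proof.
move=> F0; elim: k => [|k IH]; first by rewrite !big_ord0 logn1.
by rewrite !big_ord_recr /= lognM ?IH ?prodn_gt0.
Qed.

Lemma dvdn_lognP d n : (0 < d)%N -> (0 < n)%N ->
  (forall p, prime p -> (logn p d <= logn p n)%N) -> (d %| n)%N.
Proof.
move=> d0 n0 h; apply/dvdn_partP => // p; rewrite mem_primes => /and3P [pp _ _].
by rewrite p_part pfactor_dvdn // h.
Qed.

Lemma gdvd_gprodP (f : nat -> nat) d : (0 < d)%N -> (forall k, 0 < f k)%N ->
  gdvd (gint_of_nat d) (gprod f) <-> exists k, (d %| \prod_(j < k) f j)%N.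
Proof.
move=> d0 f0; split=> [/gdvdP h|[k dk]].
  have /epsilon_choice [K hK] : forall p, exists N, prime p ->
      (logn p d <= \sum_(j < N) logn p (f j))%N.
    move=> p; case: (boolP (prime p)) => pp; last by exists 0.
    by have /ele_esum [N] := h p pp (logn p d) (leqnn _); exists N.
  (* Only primes up to [d] can divide [d], so the largest of finitely many bounds serves them
     all. *)
  exists (\max_(i < d.+1) K i); apply: dvdn_lognP => [//||p pp].
    by rewrite prodn_gt0.
  rewrite logn_prod //; have [pd|pd] := leqP p d; last first.
    by rewrite lognE pp d0 /= gtnNdvd.
  apply: leq_trans (hK p pp) (leq_sum_ord (fun i => logn p (f i)) _).
  exact: (leq_bigmax (F := fun i : 'I_d.+1 => K i) (Ordinal (n := d.+1) pd)).
apply/gdvdP => p pp l /= ld; apply/ele_esum; exists k.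
by rewrite -logn_prod //; apply: leq_trans ld (dvdn_leq_log p _ dk); rewrite prodn_gt0.
Qed.

(** [W k] truncates [m] to the primes below [k] and to exponents at most [k]. These numbers form a
    divisibility chain starting at 1, whose successive quotients are the required factors. *)
Lemma gprod_surj (m : gint) :
  exists f : nat -> nat, (forall k, 0 < f k)%N /\ Defs.geq (gprod f) m.
Proof.
pose c k i := if m i is Some x then minn x k else k.
pose w k i := if prime i then (i ^ c k i)%N else 1%N.
pose W k := (\prod_(i < k) w k i)%N.
have w0 k i : (0 < w k i)%N.
  by rewrite /w; case: ifP => // pi; rewrite expn_gt0 prime_gt0.
have W0 k : (0 < W k)%N by rewrite prodn_gt0.
have lW p k : prime p -> logn p (W k) = if (p < k)%N then c k p else 0%N.
  move=> pp; rewrite logn_prod //.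
  have lw i : logn p (w k i) = if i == p then c k p else 0%N.
    rewrite /w; have [->|ip] := eqVneq i p; first by rewrite pp pfactorK.
    case: ifP => pi; last by rewrite logn1.
    by rewrite lognX logn_prime // eq_sym (negPf ip) muln0.
  have [pk|kp] := ltnP p k.
    rewrite (bigD1 (Ordinal pk)) //= lw eqxx big1 ?addn0 // => i ik.
    by rewrite lw; case: eqP => // ip; case/eqP: ik; apply: val_inj.
  rewrite big1 // => i _; rewrite lw; case: eqP => // ip.
  by have := ltn_ord i; lia.
have cS k p : (c k p <= c k.+1 p)%N by rewrite /c; case: (m p) => [x|]; lia.
have WS k : (W k %| W k.+1)%N.
  apply: dvdn_lognP => // p pp; rewrite !lW //; have := cS k p.
  by case: (ltnP p k) => ?; case: (ltnP p k.+1) => ?; lia.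
exists (fun k => W k.+1 %/ W k)%N; split=> [k|p pp].
  by rewrite divn_gt0 // dvdn_leq.
have tel k : (\sum_(j < k) logn p (W j.+1 %/ W j))%N = logn p (W k).
  elim: k => [|k IH]; first by rewrite big_ord0 /W big_ord0 logn1.
  by rewrite big_ord_recr /= IH logn_div // subnKC // dvdn_leq_log.
apply: ele_inj => l; apply/idP/idP; rewrite /gprod.
  move=> /ele_esum [N]; rewrite tel lW //; case: ifP => _; last first.
    by rewrite leqn0 => /eqP ->; case: (m p).
  by rewrite /c; case: (m p) => //= x; lia.
move=> lm; apply/ele_esum; exists (maxn l p.+1); rewrite tel lW //.
rewrite leq_max leqnn orbT /c; case: (m p) lm => /= [x|]; lia.
Qed.

(** * The groups 1/N Z, given by [grid N], and their cyclic extensions *)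

Definition grid (N : nat) (x : rat) : bool := x * N%:R \is a Num.int.

Lemma grid0 N : grid N 0.
Proof. by rewrite /grid mul0r rpred0. Qed.

Lemma gridD N x y : grid N x -> grid N y -> grid N (x + y).
Proof. by rewrite /grid mulrDl; exact: rpredD. Qed.

Lemma gridB N x y : grid N x -> grid N y -> grid N (x - y).
Proof. by rewrite /grid mulrBl; exact: rpredB. Qed.

Lemma gridMn N x n : grid N x -> grid N (x *+ n).
Proof. by rewrite /grid mulrnAl; exact: rpredMn. Qed.

Lemma grid1 N : grid N 1.
Proof. by rewrite /grid mul1r rpred_nat. Qed.

Lemma gridMr N r x : grid N x -> grid (N * r) x.
Proof. by rewrite /grid natrM mulrA => h; apply: rpredM => //; exact: rpred_nat. Qed.

Lemma grid_ge N x : (0 < N)%N -> grid N x -> 0 < x -> N%:R^-1 <= x.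
Proof.
move=> N0 /intrP [z zE] x0; have N0' : (0 : rat) < N%:R by rewrite ltr0n.
have : 0 < z%:~R :> rat by rewrite -zE mulr_gt0.
rewrite ltr0z gtz0_ge1 => z1.
rewrite -[X in X <= _]mul1r ler_pdivrMr // zE -[1]/(1%:~R) ler_int; exact: z1.
Qed.

Lemma intr_divn_int (n : int) (r : nat) : (0 < r)%N ->
  (n%:~R / r%:R : rat) \is a Num.int = (r %| n)%Z.
Proof.
move=> r0; have r0' : (r%:R : rat) != 0 by rewrite pnatr_eq0 -lt0n.
apply/intrP/dvdzP => [[z zE]|[z ->]]; exists z; last first.
  by rewrite intrM -pmulrn mulfK.
by apply: (@intr_inj rat); rewrite intrM -zE -pmulrn divfK.
Qed.

(* [d] is a generator of [1/(N r) Z] modulo [1/N Z]. *)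
Definition is_root (N r : nat) (d : rat) : bool :=
  d * N%:R - r%:R^-1 \is a Num.int.

(** Modulo the integers [d N] is [1/r], so [n d N] is [n/r]. *)
Lemma grid_rootMz N r d (n : int) : (0 < r)%N -> is_root N r d ->
  grid N (d *~ n) = (r %| n)%Z.
Proof.
move=> r0 dR; rewrite -intr_divn_int // /grid mulrzAl.
have -> : (d * N%:R) *~ n = (d * N%:R - r%:R^-1) *~ n + n%:~R / r%:R.
  by rewrite mulrzBl mulrzl subrK.
by rewrite rpredDl // rpredMz.
Qed.

Lemma grid_root N r d : (0 < r)%N -> is_root N r d -> grid (N * r) d.
Proof.
move=> r0 dR; have r0' : (r%:R : rat) != 0 by rewrite pnatr_eq0 -lt0n.
rewrite /grid natrM mulrA -[d * _](subrK r%:R^-1) mulrDl mulVf //.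
by rewrite rpredD ?rpred1 // rpredM // rpred_nat.
Qed.

Lemma grid_root_reduce N r d x : (0 < r)%N -> is_root N r d -> grid (N * r) x ->
  exists k, (k < r)%N /\ grid N (x - d *+ k).
Proof.
move=> r0 dR /intrP [z zE]; have r0' : (r%:R : rat) != 0 by rewrite pnatr_eq0 -lt0n.
(* As [x N = z / r] and [d N] is [1/r] modulo integers, the number of copies of [d] to remove is the
   residue of [z]. *)
exists `|(z %% r)%Z|%N; set k := `|_|%N.
have kE : (k%:Z = (z %% r)%Z) by rewrite /k gez0_abs // modz_ge0 // eqz_nat -lt0n.
split; first by rewrite -ltz_nat kE ltz_pmod // ltz_nat.
have -> : x - d *+ k = x - d *~ k by rewrite pmulrn.
rewrite /grid; have -> : (x - d *~ k) * N%:R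
   = (z - k%:Z)%:~R / r%:R - (d * N%:R - r%:R^-1) *~ k.
  by rewrite rmorphB /= -zE natrM -(mulrzr d) -(mulrzr (_ - _)); field.
rewrite rpredB ?rpredMz // intr_divn_int // kE.
by rewrite {1}(divz_eq z r) addrK dvdz_mull.
Qed.

Lemma exists_root N r (B : rat) : (0 < N)%N -> (0 < r)%N ->
  exists d, is_root N r d /\ B <= d /\ 0 <= d.
Proof.
move=> N0 r0; pose k := Num.bound `|B|.
have N0' : (N%:R : rat) != 0 by rewrite pnatr_eq0 -lt0n.
have Bk : `|B| < k%:R by apply: archi_boundP.
have i0 : 0 <= (N%:R * r%:R : rat)^-1 by rewrite invr_ge0 mulr_ge0.
(* The integer [k] provides the size, and [1/(N r)] the class modulo 1/N Z. *)
exists (k%:R + (N%:R * r%:R)^-1); split.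
  rewrite /is_root mulrDl invfM mulrAC mulVf // mul1r addrK.
  by rewrite rpredM // rpred_nat.
split; last by rewrite addr_ge0.
by rewrite -[B]addr0 lerD // ltW // (le_lt_trans (ler_norm _) Bk).
Qed.

(** * Finite stages of the cone and adjunction of one root *)

Record stage (N : nat) (C : rat -> Prop) : Prop := Stage {
  stage_gt0 : (0 < N)%N;
  stage0 : C 0;
  stage1 : C 1;
  stageD : forall x y, C x -> C y -> C (x + y);
  stage_ge0 : forall x, C x -> 0 <= x;
  stage_grid : forall x, C x -> grid N x;
  stage_conductor : exists B, forall x, grid N x -> B <= x -> C x }.

Lemma stageMn N C x n : stage N C -> C x -> C (x *+ n).
Proof.
move=> sC Cx; elim: n => [|n IH]; first exact: stage0 sC.
by rewrite mulrS; exact: stageD sC _ _ Cx IH.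
Qed.

Definition adjoin (C : rat -> Prop) (d : rat) (x : rat) : Prop :=
  exists c n, C c /\ x = c + d *+ n.

Lemma adjoin_stage N C r d : stage N C -> (0 < r)%N -> is_root N r d ->
  0 <= d -> stage (N * r) (adjoin C d).
Proof.
move=> sC r0 dR d0; split.
- by rewrite muln_gt0 r0 (stage_gt0 sC).
- by exists 0, 0%N; split; [exact: stage0 sC | rewrite addr0].
- by exists 1, 0%N; split; [exact: stage1 sC | rewrite addr0].
- move=> _ _ [c [n [Cc ->]]] [c' [n' [Cc' ->]]]; exists (c + c'), (n + n')%N.
  by split; [exact: stageD sC _ _ Cc Cc' | rewrite mulrnDr addrACA].
- move=> _ [c [n [Cc ->]]]; rewrite addr_ge0 ?mulrn_wge0 //.
  exact: stage_ge0 sC _ Cc.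
- move=> _ [c [n [Cc ->]]]; apply: gridD.
    exact/gridMr/(stage_grid sC).
  exact/gridMn/grid_root.
(* The margin [d *+ r] absorbs the fewer than [r] copies of [d] removed to bring [x] back into 1/N
   Z. *)
have [B hB] := stage_conductor sC; exists (B + d *+ r) => x xG Bx.
have [k [kr kG]] := grid_root_reduce r0 dR xG.
exists (x - d *+ k), k; split; last by rewrite subrK.
apply: hB => //; rewrite lerBrDr; apply: le_trans Bx; rewrite lerD2l.
by apply: ler_wpMn2l => //; exact: ltnW.
Qed.

(* In [1/(N r) Z] modulo [1/N Z] the element [d] has order exactly [r], so a
   representation of [g + k d] uses [d] exactly [k] times modulo [r]. *)
Lemma adjoin_conservative N C r d g k : stage N C -> (0 < r)%N ->
  is_root N r d -> C (d *+ r) -> (k < r)%N -> grid N g ->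
  adjoin C d (g + d *+ k) -> C g.
Proof.
move=> sC r0 dR Cdr kr gG [c [n [Cc e]]].
have gE : g = c + d *~ (n%:Z - k%:Z).
  by rewrite mulrzBr -!pmulrn addrA -e addrK.
have : (r %| n%:Z - k%:Z)%Z.
  rewrite -(grid_rootMz _ r0 dR).
  have -> : d *~ (n%:Z - k%:Z) = g - c by rewrite gE [c + _]addrC addrK.
  exact/gridB/(stage_grid sC).
(* Since [k < r] and [n] is nonnegative, [n - k] exceeds [-r]; hence [s] is nonnegative and [g] is
   [c] plus [s] copies of [r d]. *)
case/dvdzP => s sE; have s0 : 0 <= s by nia.
rewrite gE sE mulrC mulrzA -pmulrn -(gez0_abs s0) -pmulrn.
apply: (stageD sC) => //; exact: stageMn sC Cdr.
Qed.

Lemma adjoin_sub (C : rat -> Prop) d x : C x -> adjoin C d x.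
Proof. by exists x, 0%N; rewrite addr0. Qed.

(** A root [d] chosen above the conductor has [r d] in [C] already, which is what conservativity
    needs. The bound [B] is left to the caller. *)
Lemma root_step N C r B : stage N C -> (0 < r)%N ->
  exists d, B <= d /\ 0 <= d /\ grid N (d *+ r) /\ adjoin C d d /\
    stage (N * r) (adjoin C d) /\
    forall g k, (k < r)%N -> grid N g -> adjoin C d (g + d *+ k) -> C g.
Proof.
move=> sC r0; have [B' hB'] := stage_conductor sC.
have [d [dR [Bd d0]]] := exists_root (Num.max B B') (stage_gt0 sC) r0.
move: Bd; rewrite ge_max => /andP [Bd Bd'].
have dG : grid N (d *+ r) by rewrite pmulrn (grid_rootMz _ r0 dR) dvdzz.
have Cdr : C (d *+ r).
  by apply: hB' => //; apply: le_trans Bd' _; rewrite -[X in X <= _]mulr1n ler_wpMn2l.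
exists d; do 3!split=> //; split.
  by exists 0, 1%N; split; [exact: stage0 sC | rewrite add0r].
split; first exact: adjoin_stage.
by move=> g k; exact: adjoin_conservative.
Qed.

(** * Adjunction of a Riesz decomposition *)

Definition adjoin_riesz (C : rat -> Prop) (x y1 y2 d z : rat) : Prop :=
  exists c n1 n2 n3 n4, C c /\
    z = c + d *+ n1 + (x - d) *+ n2 + (y1 - d) *+ n3 + (y2 - x + d) *+ n4.

(* Equally many generators of each sign of [d] cancel in pairs, each pair
   summing to [x], [y1], [y2] or [y1 + y2 - x]; any other combination that lies
   in [1/N Z] uses at least [r] generators, hence is large. *)
Lemma adjoin_riesz_step N C r x y1 y2 d delta : stage N C -> (0 < r)%N ->
  C x -> C y1 -> C y2 -> C (y1 + y2 - x) -> is_root N r d -> 0 < delta ->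
  delta <= d -> delta <= x - d -> delta <= y1 - d -> delta <= y2 - x + d ->
  stage (N * r) (adjoin_riesz C x y1 y2 d) /\
  forall g, grid N g -> g < delta *+ r -> adjoin_riesz C x y1 y2 d g -> C g.
Proof.
move=> sC r0 Cx Cy1 Cy2 Cyx dR D0 D1 D2 D3 D4.
have sub := stage_grid sC; have d0 : 0 <= d by lra.
have Gd := grid_root r0 dR.
split; first split.
- by rewrite muln_gt0 r0 (stage_gt0 sC).
- exists 0, 0%N, 0%N, 0%N, 0%N.
  by split; [exact: stage0 sC | rewrite !mulr0n !addr0].
- exists 1, 0%N, 0%N, 0%N, 0%N.
  by split; [exact: stage1 sC | rewrite !mulr0n !addr0].
- move=> _ _ [c [n1 [n2 [n3 [n4 [Cc ->]]]]]] [c' [m1 [m2 [m3 [m4 [Cc' ->]]]]]].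
  exists (c + c'), (n1 + m1)%N, (n2 + m2)%N, (n3 + m3)%N, (n4 + m4)%N.
  by split; [exact: stageD sC _ _ Cc Cc' | rewrite !mulrnDr; ring].
- move=> _ [c [n1 [n2 [n3 [n4 [Cc ->]]]]]].
  have c0 := stage_ge0 sC Cc.
  by rewrite !addr_ge0 // mulrn_wge0 //; lra.
- move=> _ [c [n1 [n2 [n3 [n4 [Cc ->]]]]]].
  have Gs z : C z -> grid (N * r) z by move=> Cz; exact/gridMr/sub.
  by repeat first [exact: Gs | exact: Gd | apply: gridB | apply: gridD | apply: gridMn].
- have [B hB] := stage_conductor sC; exists (B + d *+ r) => z zG Bz.
  have [k [kr kG]] := grid_root_reduce r0 dR zG.
  exists (z - d *+ k), k, 0%N, 0%N, 0%N; split; last by rewrite subrK !addr0.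
  apply: hB => //; rewrite lerBrDr; apply: le_trans Bz; rewrite lerD2l.
  by apply: ler_wpMn2l => //; exact: ltnW.
move=> g gG gM [c [n1 [n2 [n3 [n4 [Cc gE]]]]]].
(* The net coefficient of [d], which [r] must divide because the other terms lie in 1/N Z. *)
pose t : int := n1%:Z + n4%:Z - n2%:Z - n3%:Z.
have gE' : g = c + x *+ n2 + y1 *+ n3 + (y2 - x) *+ n4 + d *~ t.
  rewrite gE /t !mulrzBr mulrzDr -!pmulrn !mulrnBl !mulrnDl; ring.
have : (r %| t)%Z.
  rewrite -(grid_rootMz _ r0 dR).
  have -> : d *~ t = g - (c + x *+ n2 + y1 *+ n3 + (y2 - x) *+ n4).
    by rewrite gE' [_ + d *~ t]addrC addrK.
  by repeat first [exact: sub | exact: gG | apply: gridB | apply: gridD | apply: gridMn].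
have c0 := stage_ge0 sC Cc.
have bound n n' z z' : delta <= z -> delta <= z' -> (r <= n + n')%N ->
    delta *+ r <= z *+ n + z' *+ n'.
  move=> hz hz' rn; apply: (@le_trans _ _ (delta *+ (n + n'))).
    by apply: ler_wpMn2l => //; exact: ltW.
  by rewrite mulrnDr lerD // ler_wMn2r.
have pos z n : delta <= z -> 0 <= z *+ n.
  by move=> hz; apply: mulrn_wge0; lra.
case/dvdzP => s sE; have [s0|s0|s0] := ltrgt0P s.
- have := bound n1 n4 _ _ D1 D4; have := pos _ n2 D2; have := pos _ n3 D3.
  have rn : (r <= n1 + n4)%N by rewrite /t in sE; nia.
  by move=> h1 h2 /(_ rn) h3; lra.
- have := bound n2 n3 _ _ D2 D3; have := pos _ n1 D1; have := pos _ n4 D4.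
  have rn : (r <= n2 + n3)%N by rewrite /t in sE; nia.
  by move=> h1 h2 /(_ rn) h3; lra.
have {}sE : (n1 + n4 = n2 + n3)%N by move: sE; rewrite s0 mul0r /t; lia.
have CM z n : C z -> C (z *+ n) by exact: stageMn sC.
(* Pair as many [d] with [x - d] as possible. The excess of [x - d] pairs with [y2 - x + d] into
   [y2], or that of [d] with [y1 - d] into [y1]; the remaining pairs sum to [y1 + y2 - x]. *)
have [n12|n21] := leqP n1 n2.
  have [k n2E] : exists k, n2 = (n1 + k)%N by exists (n2 - n1)%N; lia.
  have n4E : n4 = (k + n3)%N by lia.
  have -> : g = c + x *+ n1 + y2 *+ k + (y1 + y2 - x) *+ n3.
    by rewrite gE n2E n4E; ring.
  by apply: (stageD sC); [apply: (stageD sC); [apply: (stageD sC)|]|]; auto.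
have [k n1E] : exists k, n1 = (n2 + k)%N by exists (n1 - n2)%N; lia.
have n3E : n3 = (k + n4)%N by lia.
have -> : g = c + x *+ n2 + y1 *+ k + (y1 + y2 - x) *+ n4.
  by rewrite gE n1E n3E; ring.
by apply: (stageD sC); [apply: (stageD sC); [apply: (stageD sC)|]|]; auto.
Qed.

(** The range from [max(0, x - y2)] to [min(x, y1)] has length at least [1/N]. The factor [b1], at
    least 3, makes room for a [d] at distance at least [delta = 1/(N b1)] from both ends; the factor
    [b2] is its order, and the hypothesis on [M] says that [b2] times [delta] is at least [M]. *)
Lemma riesz_step N C x y1 y2 b1 b2 M : stage N C -> (2 < b1)%N -> (0 < b2)%N ->
  M * (N * b1)%:R <= b2%:R ->
  exists C', stage (N * b1 * b2) C' /\ (forall z, C z -> C' z) /\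
    (forall g, grid N g -> g < M -> C' g -> C g) /\
    (C x -> C y1 -> C y2 -> C (y1 + y2 - x) ->
     exists z, C' z /\ C' (x - z) /\ C' (y1 - z) /\ C' (y2 - x + z)).
Proof.
move=> sC b1_2 b2_0 Mb; have N0 := stage_gt0 sC.
have b1_0 : (0 < b1)%N by lia.
have [d1 [_ [_ [_ [_ [sC1 cons1]]]]]] := root_step 0 sC b1_0.
set C1 := adjoin C d1 in sC1 cons1; set N1 := (N * b1)%N in sC1 Mb *.
have CC1 z : C z -> C1 z by exact: adjoin_sub.
have {}cons1 g : grid N g -> C1 g -> C g.
  by move=> gG C1g; apply: (cons1 g 0%N) => //; rewrite addr0.
case: (classic ([/\ C x, C y1, C y2 & C (y1 + y2 - x)] /\
                [/\ 0 < x, 0 < y1, 0 < y2 & 0 < y1 + y2 - x])); last first.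
  (* Here any decomposition asked for already exists in [C], with [z] equal to [0], [x] or [y1]. A
     root of order [b2] is adjoined only to reach the same denominator. *)
  move=> degen; have [d2 [_ [_ [_ [_ [sC2 cons2]]]]]] := root_step 0 sC1 b2_0.
  exists (adjoin C1 d2); split=> //; split; first by move=> z /CC1; exact: adjoin_sub.
  split=> [g gG _ C2g|Cx Cy1 Cy2 Cyx].
    apply: cons1 => //; apply: (cons2 g 0%N) => //; first exact: gridMr.
    by rewrite addr0.
  have sub z : C z -> adjoin C1 d2 z by move=> /CC1; exact: adjoin_sub.
  have C0 := stage0 sC.
  suff [z [Hz1 [Hz2 [Hz3 Hz4]]]] :
      exists z, C z /\ C (x - z) /\ C (y1 - z) /\ C (y2 - x + z).
    by exists z; do !split; exact: sub.
  have x0 := stage_ge0 sC Cx; have y10 := stage_ge0 sC Cy1.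
  have y20 := stage_ge0 sC Cy2; have yx0 := stage_ge0 sC Cyx.
  move: x0; rewrite le_eqVlt => /orP [/eqP x0|x0].
    by exists 0; rewrite -x0 !subr0 ?addr0.
  move: y10; rewrite le_eqVlt => /orP [/eqP y10|y10].
    exists 0; rewrite !subr0 ?addr0; split=> //; split=> //; split=> //.
    by rewrite -[y2]add0r y10.
  move: y20; rewrite le_eqVlt => /orP [/eqP y20|y20].
    exists x; rewrite subrr subrK; split=> //; split=> //; split=> //.
    by rewrite -[y1]addr0 y20.
  move: yx0; rewrite le_eqVlt => /orP [/eqP yx0|yx0]; last first.
    by case: degen; split; split.
  exists y1; rewrite subrr; split=> //.
  have -> : x - y1 = y2 by lra.
  by have -> : y2 - x + y1 = 0 by lra.
case=> [[Cx Cy1 Cy2 Cyx] [x0 y10 y20 yx0]].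
have gx := stage_grid sC Cx; have gy1 := stage_grid sC Cy1.
have gy2 := stage_grid sC Cy2; have gyx := stage_grid sC Cyx.
have hx := grid_ge N0 gx x0; have hy1 := grid_ge N0 gy1 y10.
have hy2 := grid_ge N0 gy2 y20; have hyx := grid_ge N0 gyx yx0.
pose l := Num.max 0 (x - y2).
have gl : grid N1 l.
  apply: gridMr; rewrite /l; case: (leP 0 (x - y2)) => _; last exact: grid0.
  exact: gridB.
have [l0 lx] : 0 <= l /\ x - y2 <= l by rewrite !le_max !lexx orbT.
have [lx' ly1] : N%:R^-1 <= x - l /\ N%:R^-1 <= y1 - l.
  by rewrite /l; case: (leP 0 (x - y2)) => _; split; lra.
have N1_0 : (0 < N1)%N by rewrite muln_gt0 N0.
pose delta : rat := N1%:R^-1.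
have D0 : 0 < delta by rewrite invr_gt0 ltr0n.
have D3 : delta *+ 3 <= N%:R^-1.
  have -> : (N%:R : rat)^-1 = delta *+ b1.
    rewrite /delta /N1 natrM invfM -mulrnAr -[_ *+ b1]mulr_natr mulVf ?mulr1 //.
    by rewrite pnatr_eq0 -lt0n.
  by apply: ler_wpMn2l => //; exact: ltW.
have b2V : b2%:R^-1 <= (1 : rat) by rewrite invf_le1 ?ltr0n // ler1n.
have b2V0 : 0 < b2%:R^-1 :> rat by rewrite invr_gt0 ltr0n.
have e1 : delta * b2%:R^-1 <= delta by rewrite -[X in _ <= X]mulr1 ler_pM2l.
have e0 : 0 < delta * b2%:R^-1 by rewrite mulr_gt0.
pose d := l + delta + delta * b2%:R^-1.
have dR : is_root N1 b2 d.
  have N1V : delta * N1%:R = 1 by rewrite mulVf // pnatr_eq0 -lt0n.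
  rewrite /is_root /d !mulrDl N1V mulrAC N1V mul1r addrK.
  by rewrite rpredD ?rpred1.
have [||||sC2 cons2] := adjoin_riesz_step sC1 b2_0 (CC1 _ Cx) (CC1 _ Cy1)
  (CC1 _ Cy2) (CC1 _ Cyx) dR D0.
- by rewrite /d; lra.
- by rewrite /d; lra.
- by rewrite /d; lra.
- by rewrite /d; lra.
exists (adjoin_riesz C1 x y1 y2 d); split=> //.
have C10 := stage0 sC1.
split=> [z /CC1 Cz|].
  by exists z, 0%N, 0%N, 0%N, 0%N; rewrite !addr0.
split=> [g gG gM C2g|_ _ _ _].
  apply: cons1 => //; apply: cons2 => //; first exact: gridMr.
  apply: lt_le_trans gM _; rewrite -mulr_natl ler_pdivlMr ?ltr0n //.
exists d; split; first by exists 0, 1%N, 0%N, 0%N, 0%N; rewrite !addr0 add0r.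
split; first by exists 0, 0%N, 1%N, 0%N, 0%N; rewrite !addr0 add0r.
split; first by exists 0, 0%N, 0%N, 1%N, 0%N; rewrite !addr0 add0r.
by exists 0, 0%N, 0%N, 0%N, 1%N; rewrite !addr0 add0r.
Qed.

(** * Inductive construction of the stages *)

Definition task (k : nat) : rat * rat * rat :=
  if (unpickle k : option (nat * (rat * rat * rat))) is Some (_, t) then t
  else (0, 0, 0).

(** The codes of the pairs [(j, t)] are distinct, so they cannot all lie below [K]. A triple thus
    recurs after its entries have entered the cone. *)
Lemma task_infinitely_often t K : exists k, (K <= k)%N /\ task k = t.
Proof.
apply: NNPP => nE.
pose code (j : nat) := pickle (j, t).
have code_lt j : (code j < K)%N.
  rewrite ltnNge; apply/negP => Kj; apply: nE; exists (code j).
  by split=> //; rewrite /task /code pickleK.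
have : (size [seq code j | j <- iota 0 K.+1] <= size (iota 0 K))%N.
  apply: uniq_leq_size.
    rewrite map_inj_uniq ?iota_uniq // => i j.
    by move=> /(pcan_inj pickleK) [].
  by move=> _ /mapP [j _ ->]; rewrite mem_iota add0n code_lt.
by rewrite size_map !size_iota ltnn.
Qed.

(** [used] bounds the indices of the terms of [b] already spent, so that no term is spent twice. *)
Record state := State {
  den : nat; cone : rat -> Prop; top : nat -> rat; used : nat }.

(* [top s v] is the current element of the chain whose downset becomes the
   interval attached to [v]; the last clause keeps [1] out of [(v - 1) D]. *)
Definition good (s : state) : Prop :=
  stage (den s) (cone s) /\ (forall v, cone s (top s v)) /\
  (exists M, forall v, top s v *+ v <= M) /\
  (forall v, (0 < v)%N -> ~ cone s (top s v *+ v.-1 - 1)).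

(** [v] is the entry of the chain to enlarge, [r] the factor taken from the prescribed generalized
    integer, [beta] the factor paid for by fresh terms of [b]. The number [k] is both the index of
    the Riesz task and the size up to which [v] copies of the new top must dominate. *)
Definition successor (b : nat -> nat) (v r k : nat) (s s' : state) (beta : nat) : Prop :=
  ((0 < beta)%N /\ den s' = den s * (v * beta * r))%N /\
  (forall p, logn p beta + \sum_(i < used s) logn p (b i)
             <= \sum_(i < used s') logn p (b i))%N /\
  (forall x, cone s x -> cone s' x) /\
  (forall w, cone s' (top s' w - top s w)) /\
  (forall z, grid (den s) z -> z <= k%:R -> cone s' (top s' v *+ v - z)) /\
  (let: (x, y1, y2) := task k in
   cone s x -> cone s y1 -> cone s y2 -> cone s (y1 + y2 - x) ->
   exists z, cone s' z /\ cone s' (x - z) /\ cone s' (y1 - z) /\ cone s' (y2 - x + z)).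

(** Three adjunctions follow each other: a Riesz decomposition, a root [d] of order [v] added to
    [top s v], and a root of order [r]. Forbidden elements are traced back through them: the last
    adds nothing, the second involves at most [v - 1] copies of [d], and the first adds to the old
    grid only elements of size at least [M]. *)
Lemma successor_exists (b : nat -> nat) v r k s :
  (forall i, b i < b i.+1)%N -> (0 < v)%N -> (0 < r)%N -> good s ->
  exists s', good s' /\ exists beta, successor b v r k s s' beta.
Proof.
move=> hb v0 r0 [sC [CX [[M hM] forb]]].
have b_ge i : (i <= b i)%N by elim: i => // i IH; exact: leq_ltn_trans IH (hb i).
(* Both indices are fresh; the 3 ensures [b i1 > 2], and [i2] is large enough for the size condition
   on the Riesz step. *)
pose i1 := maxn (used s) 3.
pose i2 := maxn i1.+1 (Num.bound (M * (den s * b i1)%:R)).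
have i1_3 : (2 < b i1)%N by apply: leq_trans (b_ge i1); rewrite leq_max orbT.
have i2_0 : (0 < b i2)%N by apply: leq_trans (b_ge i2); rewrite leq_max.
have Mb : M * (den s * b i1)%:R <= (b i2)%:R.
  apply: le_trans (ltW (@archi_boundP _ (M * (den s * b i1)%:R) _)) _.
    (* The bound at [v = 0] reads [0 <= M]. *)
    rewrite mulr_ge0 //; apply: le_trans (hM 0%N); exact: lexx.
  by rewrite ler_nat; apply: leq_trans (b_ge i2); rewrite leq_max leqnn orbT.
case task_k: (task k) => [[x y1] y2].
have [C1 [sC1 [CC1 [cons1 riesz1]]]] := riesz_step x y1 y2 sC i1_3 i2_0 Mb.
set N1 := (den s * b i1 * b i2)%N in sC1.
have NN1 z : grid (den s) z -> grid N1 z by move=> h; exact/gridMr/gridMr.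
have [B1 hB1] := stage_conductor sC1.
(* With [d] at least [B1 + k], subtracting any [z <= k] from [v] copies of the new top stays above
   the conductor [B1]. *)
have [d [Bd [d0 [dG [Cd [sC2 cons2]]]]]] := root_step (B1 + k%:R) sC1 v0.
set C2 := adjoin C1 d in Cd sC2 cons2; set N2 := (N1 * v)%N in sC2.
have [e [_ [_ [_ [_ [sC3 cons3]]]]]] := root_step 0 sC2 r0.
set C3 := adjoin C2 e in sC3 cons3; set N3 := (N2 * r)%N in sC3.
have CC2 z : C1 z -> C2 z by exact: adjoin_sub.
have CC3 z : C2 z -> C3 z by exact: adjoin_sub.
pose X w := if w == v then top s w + d else top s w.
have gX w : grid (den s) (top s w) by exact: stage_grid sC _ (CX w).
have gF w n : grid (den s) (top s w *+ n - 1).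
  by apply: gridB; [exact: gridMn | exact: grid1].
have gX2 w : grid N2 (X w).
  rewrite /X; case: eqP => _; last exact/gridMr/NN1.
  by apply: gridD; [exact/gridMr/NN1 | exact: stage_grid sC2 _ Cd].
exists (State N3 C3 X i2.+1); split; first split=> //=.
  split=> [w|].
    rewrite /X; case: eqP => _; last by apply/CC3/CC2/CC1.
    by apply: (stageD sC3); [apply/CC3/CC2/CC1 | apply/CC3].
  split.
    exists (Num.max M (X v *+ v)) => w; rewrite le_max.
    have [->|wv] := eqVneq w v; first by rewrite lexx orbT.
    by rewrite /X (negPf wv) hM.
  move=> w w0 /= C3w; apply: (forb w w0).
  have {C3w} C2w : C2 (X w *+ w.-1 - 1).
    apply: (cons3 _ 0%N) => //; last by rewrite addr0.
    by apply: gridB; [exact: gridMn | exact: grid1].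
  apply: cons1 => //.
    rewrite ltrBlDr; apply: (@le_lt_trans _ _ M); last by rewrite ltrDl.
    apply: le_trans (hM w); apply: ler_wpMn2l; last exact: leq_pred.
    exact: stage_ge0 sC _ (CX w).
  (* For [w = v] the new part is [v - 1] copies of [d], fewer than its order, so conservativity
     strips them off. *)
  move: C2w; rewrite /X; case: eqP => [->|_] C2w.
    apply: (cons2 _ v.-1); [by rewrite prednK | exact: NN1 |].
    by rewrite -addrA [-1 + _]addrC addrA -mulrnDl.
  by apply: (cons2 _ 0%N) => //; [exact: NN1 | rewrite addr0].
exists (b i1 * b i2)%N; rewrite /successor task_k /=.
split; first by rewrite muln_gt0 i2_0 /N3 /N2 /N1; split; lia.
split=> [p|].
  rewrite lognM //; last by lia.
  have i12 : (i1 < i2)%N by rewrite leq_max leqnn.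
  have ui1 : (used s <= i1)%N by rewrite leq_max leqnn.
  rewrite big_ord_recr /=.
  have h1 := leq_sum_ord (fun i => logn p (b i)) i12.
  have h2 := leq_sum_ord (fun i => logn p (b i)) ui1.
  by move: h1 h2; rewrite big_ord_recr /=; lia.
split; first by move=> z Cz; apply/CC3/CC2/CC1.
split=> [w|].
  rewrite /X; case: eqP => _; last by rewrite subrr; exact: stage0 sC3.
  by rewrite addrC addKr; exact: CC3.
split=> [z zG zk|Cx Cy1 Cy2 Cyx].
  apply/CC3/CC2/hB1.
    apply: gridB; last exact: NN1.
    by rewrite /X eqxx mulrnDl; apply: gridD => //; exact/gridMn/NN1.
  rewrite /X eqxx mulrnDl.
  have h1 : 0 <= top s v *+ v by apply: mulrn_wge0; exact: stage_ge0 sC _ (CX v).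
  have h2 : d <= d *+ v by rewrite -[X in X <= _]mulr1n ler_wpMn2l.
  by lra.
have [z [h1 [h2 [h3 h4]]]] := riesz1 Cx Cy1 Cy2 Cyx.
by exists z; do !split; apply/CC3/CC2.
Qed.

Definition initial_state : state :=
  State 1 (fun x => exists n : nat, x = n%:R) (fun _ => 0) 0.

Lemma initial_good : good initial_state.
Proof.
split; first split=> //=.
- by exists 0%N.
- by exists 1%N.
- by move=> _ _ [n ->] [n' ->]; exists (n + n')%N; rewrite natrD.
- by move=> _ [n ->].
- by move=> _ [n ->]; rewrite /grid mulr1 rpred_nat.
- exists 0 => x; rewrite /grid mulr1 => /intrP [z ->]; rewrite ler0z => z0.
  by exists `|z|%N; rewrite natr_absz ger0_norm.
split=> [v|]; first by exists 0%N.
split; first by exists 0 => v; rewrite /= mul0rn.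
move=> v _ /= [n]; rewrite mul0rn add0r => h.
by have : (0 : rat) <= -1 by rewrite h.
Qed.

Lemma state_sequence (a b mu : nat -> nat) :
  (forall i, b i < b i.+1)%N -> (forall k, 0 < a k)%N -> (forall k, 0 < mu k)%N ->
  exists (st : nat -> state) (beta : nat -> nat), st 0%N = initial_state /\
    (forall k, good (st k)) /\
    (forall k, successor b (a k) (mu k) k (st k) (st k.+1) (beta k)).
Proof.
move=> hb a0 mu0.
have /epsilon_choice [next hnext] : forall ks : nat * state, exists s',
    good ks.2 -> good s' /\
      exists beta, successor b (a ks.1) (mu ks.1) ks.1 ks.2 s' beta.
  move=> [k s] /=; have [gs|ngs] := classic (good s); last by exists s.
  by have [s' h] := successor_exists k hb (a0 k) (mu0 k) gs; exists s'.
pose st := fix st k := if k is k'.+1 then next (k', st k') else initial_state.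
have gst k : good (st k).
  by elim: k => [|k IH]; [exact: initial_good | case: (hnext (k, st k) IH)].
have /epsilon_choice [beta hbeta] : forall k, exists beta,
    successor b (a k) (mu k) k (st k) (st k.+1) beta.
  by move=> k; case: (hnext (k, st k) (gst k)).
by exists st, beta.
Qed.

(** * The union of the stages and its intervals *)

Lemma gdvd_geq n m m' : Defs.geq m m' -> gdvd n m <-> gdvd n m'.
Proof. by move=> e; rewrite !gdvdP; split=> h p pp l /(h p pp); rewrite e. Qed.

Lemma Zgen_grid (N : gint) (f : nat -> nat) x : (forall k, 0 < f k)%N ->
  Defs.geq (gprod f) N ->
  Zgen N x <-> exists k, grid (\prod_(j < k) f j)%N x.
Proof.
move=> f0 fN; split=> [[z [d [d0 [/(gdvd_geq _ fN)]]]]|[k /intrP [z zE]]].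
  move=> /(gdvd_gprodP d0 f0) [k /dvdnP [t dE]] ->.
  have d0' : (d%:R : rat) != 0 by rewrite pnatr_eq0 -lt0n.
  exists k; rewrite /grid dE natrM.
  have -> : z%:~R / d%:R * (t%:R * d%:R) = z%:~R * t%:R :> rat by field.
  by rewrite rpredM // ?rpred_nat // rpred_int_num.
have F0 : (0 < \prod_(j < k) f j)%N by rewrite prodn_gt0.
exists z, (\prod_(j < k) f j)%N; split=> //; split; last first.
  by rewrite -zE mulfK // pnatr_eq0 -lt0n.
by apply/(gdvd_geq _ fN)/gdvd_gprodP => //; exists k.
Qed.

Theorem theorem6p1 (q a b : nat -> nat) (m : gint)
  (hq : forall i j, i <> j -> coprime (q i) (q j))
  (ha : forall j, exists i, a j = q i)
  (hainf : forall i N, exists j, (N <= j)%N /\ a j = q i)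
  (hb : forall i, (b i < b i.+1)%N)
  (hqb : forall i j, coprime (q i) (b j))
  (hm : gcoprime m (gmul (gprod a) (gprod b))) :
  exists (G : zmodType) (P : G -> Prop),
    is_po_group P /\ is_simple P /\ is_riesz P /\ rank_one G /\
    (forall i, exists D : G -> Prop,
        is_interval P D /\ countably_generated P D /\
        (forall t, (0 < t)%N -> (t <= q i - 1)%N -> ~ is_cone P (mult_set P t D)) /\
        is_cone P (mult_set P (q i) D)) /\
    (exists D : G -> Prop,
        is_interval P D /\ forall n, (0 < n)%N -> ~ is_cone P (mult_set P n D)) /\
    (exists n : gint, gdvd n (gprod b) /\
        iso_Zgen G (gmul (gmul (gprod a) n) m)).
Proof.
have q0 i : (0 < q i)%N.
  (* Zero is coprime only to 1, and a strictly increasing [b] is not constantly 1. *)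
  rewrite lt0n; apply/eqP => qi0.
  have b1 j : b j = 1%N by have := hqb i j; rewrite qi0 /coprime gcd0n => /eqP.
  by have := hb 0%N; rewrite !b1.
have a0 k : (0 < a k)%N by have [i ->] := ha k.
have [mu [mu0 muE]] := gprod_surj m.
have [st [beta [st0 [gst sst]]]] := state_sequence hb a0 mu0.
have sC k : stage (den (st k)) (cone (st k)) by case: (gst k).
have beta0 k : (0 < beta k)%N by case: (sst k) => [[]].
pose c k := (a k * beta k * mu k)%N.
have c0 k : (0 < c k)%N by rewrite !muln_gt0 a0 beta0 mu0.
have denE k : den (st k) = (\prod_(j < k) c j)%N.
  elim: k => [|k IH]; first by rewrite st0 big_ord0.
  by rewrite big_ord_recr -IH /=; case: (sst k) => [[]].
have gridS k k' x : (k <= k')%N -> grid (den (st k)) x -> grid (den (st k')) x.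
  move=> /subnKC <-; elim: (k' - k)%N => [|j IH]; first by rewrite addn0.
  by move=> /IH; rewrite addnS !denE big_ord_recr /=; exact: gridMr.
have coneS k k' x : (k <= k')%N -> cone (st k) x -> cone (st k') x.
  move=> /subnKC <-; elim: (k' - k)%N => [|j IH]; first by rewrite addn0.
  by move=> /IH; rewrite addnS; case: (sst (k + j)%N) => _ [_ [h _]]; exact: h.
pose S x := exists k, grid (den (st k)) x.
pose P x := exists k, cone (st k) x.
have PS x : P x -> S x by move=> [k /(stage_grid (sC k))]; exists k.
have P0 x : P x -> 0 <= x by move=> [k]; exact: stage_ge0 (sC k) x.
have PD x y : P x -> P y -> P (x + y).
  move=> [k xk] [k' yk']; exists (maxn k k'); apply: (stageD (sC _)).
    exact: coneS (leq_maxl _ _) xk.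
  exact: coneS (leq_maxr _ _) yk'.
have PMn x n : P x -> P (x *+ n) by move=> [k xk]; exists k; exact: stageMn (sC k) xk.
have Pzero : P 0 by exists 0%N; exact: stage0 (sC _).
have Pone : P 1 by exists 0%N; exact: stage1 (sC _).
pose T k v := top (st k) v.
have PT k v : P (T k v) by exists k; case: (gst k) => _ [h _]; exact: h.
have TS k k' v : (k <= k')%N -> cone (st k') (T k' v - T k v).
  move=> /subnKC <-; elim: (k' - k)%N => [|j IH].
    by rewrite addn0 subrr; exact: stage0 (sC _).
  rewrite addnS -(subrKA (T (k + j)%N v)); apply: (stageD (sC _)).
    by case: (sst (k + j)%N) => _ [_ [_ [h _]]]; exact: h.
  exact: coneS (leqnSn _) IH.
(* If this element lay in the cone of stage [j], adding [v - 1] times the growth of the chain would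
   give the forbidden element of stage [maxn k j]. *)
have Tsmall k v : (0 < v)%N -> ~ P (T k v *+ v.-1 - 1).
  move=> v0 [j jP]; pose l := maxn k j.
  have [_ [_ [_ /(_ v v0)]]] := gst l; apply; rewrite -/(T l v).
  have -> : T l v *+ v.-1 - 1 = (T l v - T k v) *+ v.-1 + (T k v *+ v.-1 - 1).
    by rewrite mulrnBl addrA subrK.
  apply: (stageD (sC _)); last exact: coneS (leq_maxr _ _) jP.
  by apply: stageMn (sC _) _; apply: TS; exact: leq_maxl.
have [G [f [f_inj [fS f_surj]]]] : exists (G : zmodType) (f : {additive G -> rat}),
    injective f /\ (forall x, S (f x)) /\ (forall y, S y -> exists x, f x = y).
  apply: subgroup_zmodType => [|x y [k xk] [k' yk']]; first exact: PS.
  exists (maxn k k'); apply: gridB.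
    exact: gridS (leq_maxl _ _) xk.
  exact: gridS (leq_maxr _ _) yk'.
have lift x : P x -> exists g, f g = x by move=> /PS /f_surj.
have [one oneE] := lift 1 Pone.
have one_neq0 : one != 0.
  by apply/eqP => one0; move: oneE; rewrite one0 raddf0 => /eqP; rewrite eq_sym oner_eq0.
(* Multiples of [f u] outgrow the conductor of a stage whose cone contains [f u] and whose grid
   contains [f g]; this makes [u] an order-unit. *)
have large g u : P (f u) -> u != 0 -> exists n, P (f u *+ n - f g).
  move=> Pu u0; have [k gk] := fS g; have [k' uk'] := Pu; pose l := maxn k k'.
  have [B hB] := stage_conductor (sC l).
  have fu0 : 0 < f u.
    rewrite lt_def P0 // andbT; apply/eqP => fu0.
    by case/eqP: u0; apply: f_inj; rewrite fu0 raddf0.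
  pose n := Num.bound (`|B + f g| / f u); exists n, l; apply: hB.
    apply: gridB; last exact: gridS (leq_maxl _ _) gk.
    apply/gridMn/(stage_grid (sC _)).
    exact: coneS (leq_maxr _ _) uk'.
  rewrite lerBrDr; apply: le_trans (ler_norm _) _.
  rewrite -mulr_natl -ler_pdivrMr //.
  by apply/ltW/archi_boundP; rewrite divr_ge0 // ltW.
exists G, (fun g => P (f g)).
rewrite /is_cone /mult_set /is_interval /countably_generated /pleq.
split.
  split; first by rewrite raddf0.
  split; first by move=> x y; rewrite raddfD; exact: PD.
  move=> x Px; rewrite raddfN => /P0; rewrite oppr_ge0 => x0.
  by apply: f_inj; rewrite raddf0; apply/eqP; rewrite eq_le x0 P0.
split.
  split; first by exists one.
  move=> u Pu u0; split=> // x; have [n h] := large x u Pu u0.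
  by exists n; rewrite /pleq raddfB raddfMn.
split.
  move=> x y1 y2 [k1 h1] [k2 h2] [k3 h3]; rewrite /pleq raddfB raddfD => [[k4 h4]].
  (* The triple is treated at a stage whose cone already contains its entries and [y1 + y2 - x]. *)
  have [k [kl kt]] := task_infinitely_often (f x, f y1, f y2)
    (maxn (maxn k1 k2) (maxn k3 k4)).
  have [_ [_ [_ [_ [_]]]]] := sst k; rewrite kt.
  move: kl; rewrite !geq_max => /andP [/andP [l1 l2] /andP [l3 l4]].
  move=> /(_ (coneS _ _ _ l1 h1) (coneS _ _ _ l2 h2) (coneS _ _ _ l3 h3)
            (coneS _ _ _ l4 h4)) [z [z1 [z2 [z3 z4]]]].
  have [g gE] := lift z (ex_intro _ k.+1 z1).
  exists g, (x - g); rewrite !(raddfB f) gE [g + _]addrC subrK; split=> //.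
  do 3!(split; first by exists k.+1).
  by exists k.+1; rewrite opprB addrA addrAC.
split.
  split; last by exists one.
  by exists f; split=> //; exact: raddfD.
split.
  move=> i; pose v := q i.
  have /epsilon_choice [Tg TgE] : forall k, exists g, f g = T k v.
    by move=> k; exact: lift (PT k v).
  have TgS k k' x : (k <= k')%N -> P (f (Tg k - x)) -> P (f (Tg k' - x)).
    move=> kk' kx; rewrite -(subrKA (Tg k)) raddfD; apply: PD => //.
    by exists k'; rewrite raddfB !TgE; exact: TS.
  (* The downset of the chain [Tg]; the chain itself is the countable cofinal subset. *)
  exists (fun g => P (f g) /\ exists k, P (f (Tg k - g))); split.
    split; first by move=> x [].
    split; first by exists 0; rewrite raddf0; split=> //; exists 0%N; rewrite subr0 TgE.
    split.
      move=> x y [Px [k xk]] [Py [k' yk']]; exists (Tg (maxn k k')); split; [split|].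
      - by rewrite TgE.
      - by exists (maxn k k'); rewrite subrr raddf0.
      by split; [exact: TgS (leq_maxl _ _) xk | exact: TgS (leq_maxr _ _) yk'].
    move=> x y [Px [k xk]] Py yx; split=> //; exists k.
    by rewrite -(subrKA x) raddfD; exact: PD.
  split.
    exists Tg; split=> [n|x [_ //]].
    by rewrite TgE; split=> //; exists n; rewrite subrr raddf0.
  split=> [t t0 tv /(_ one) [_]|z].
    rewrite oneE => /(_ Pone) [_ [xs [sz [xsD xs1]]]].
    (* A sum of [t] elements lies below [t] copies of a single chain element. Since [t <= v - 1],
       dominating 1 would put [(v - 1) T - 1] in the cone. *)
    suff [k kP] : exists k, P (T k v *+ size xs - f (\sum_(x <- xs) x)).
      apply: (@Tsmall k v (q0 i)).
      have -> : T k v *+ v.-1 - 1 = T k v *+ (v.-1 - size xs)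
          + ((T k v *+ size xs - f (\sum_(x <- xs) x)) + (f (\sum_(x <- xs) x) - 1)).
        rewrite subrKA addrA -mulrnDr subnK // sz -subn1; exact: tv.
      apply: (PD); first exact: PMn.
      by apply: PD => //; rewrite -oneE -raddfB.
    elim: xs xsD {sz xs1} => [|x xs IH] xsD.
      by exists 0%N; rewrite big_nil raddf0 subr0.
    have [|k kP] := IH; first by move=> y yxs; apply: xsD; rewrite in_cons yxs orbT.
    have [_ [k' k'P]] := xsD x (mem_head _ _).
    pose l := maxn k k'; exists l; rewrite big_cons raddfD /= mulrS.
    have -> : T l v + T l v *+ size xs - (f x + f (\sum_(y <- xs) y))
       = (T l v - T k' v) + (T l v - T k v) *+ size xs
         + (f (Tg k' - x) + (T k v *+ size xs - f (\sum_(y <- xs) y))).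
      by rewrite raddfB TgE mulrnBl; ring.
    apply: (PD); apply: PD => //.
      by exists l; apply: TS; exact: leq_maxr.
    by apply: PMn; exists l; apply: TS; exact: leq_maxl.
  split=> [[] //|Pz]; split=> //.
  have [kz zk] := Pz; have z0 := P0 _ Pz.
  (* Stage [k] enlarges the chain of [q i] after [z] has appeared and with threshold [k] above [z],
     so [v] copies of the next chain element dominate [z]. *)
  have [k [kl ak]] := hainf i (maxn kz (Num.bound (f z))).
  move: kl; rewrite geq_max => /andP [kzk zb].
  have [_ [_ [_ [_ [hz _]]]]] := sst k; rewrite ak in hz.
  exists (nseq v (Tg k.+1)); split; first by rewrite size_nseq.
  split.
    move=> x /nseqP [-> _]; rewrite TgE; split=> //.
    by exists k.+1; rewrite subrr raddf0.
  rewrite big_nseq -[iter _ _ _]/(iter v (+%R (Tg k.+1)) 0) iter_addr_0 raddfB raddfMn TgE.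
  exists k.+1; apply: hz.
    by apply: gridS kzk _; exact: (stage_grid (sC _)).
  apply/ltW/(lt_le_trans (archi_boundP z0)); by rewrite ler_nat.
split.
  (* Every multiple of the zero interval is zero, whereas [one] is in the cone. *)
  exists (fun x => x = 0); split.
    split; first by move=> x ->; rewrite raddf0.
    split; first by exists 0.
    split; first by move=> x y -> ->; exists 0; rewrite subrr raddf0.
    move=> x y -> Py; rewrite sub0r raddfN => /P0; rewrite oppr_ge0 => y0.
    by apply: f_inj; rewrite raddf0; apply/eqP; rewrite eq_le y0 P0.
  move=> n _ /(_ one) [_]; rewrite oneE => /(_ Pone) [_ [xs [_ [xs0]]]].
  rewrite big1_seq => [|x /andP [_ /xs0]] //.
  by rewrite sub0r raddfN oneE => /P0.
(* The exponents of each [beta k] are covered by fresh terms of [b]; summing over [k], the partial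
   sums for [beta] stay below those for [b]. *)
exists (gprod beta); split.
  apply/gdvdP => p pp l /ele_esum [N hN]; apply/ele_esum; exists (used (st N)).
  apply: leq_trans hN _; elim: N => [|N IH]; first by rewrite big_ord0.
  rewrite big_ord_recr /= addnC; apply: leq_trans (leq_add (leqnn _) IH) _.
  by case: (sst N) => _ [h _]; exact: h.
have NE : Defs.geq (gprod c) (gmul (gmul (gprod a) (gprod beta)) m).
  move=> p pp; rewrite /c gprodM // => [|k]; last by rewrite muln_gt0 a0 beta0.
  by rewrite /gmul gprodM // muE.
exists f; split; first exact: raddfD.
split=> //; split=> [x|y].
  by apply/(Zgen_grid _ c0 NE); have [k] := fS x; rewrite denE; exists k.
by move=> /(Zgen_grid _ c0 NE) [k yk]; apply: f_surj; exists k; rewrite denE.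
Qed.
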